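(* There exists a canonical routing labeling scheme for rooted trees on $n$ nodes with labels of length $\log n+\mathcal{O}\big(\sqrt{\log n\cdot\log\log n}\big)$ bits.
   Context: All logarithms are base $2$. A (designer-port) routing labeling scheme for a family $\mathcal{T}$ of rooted trees consists of an encoder and a decoder. - The encoder is given $T\in\mathcal{T}$. It assigns a binary string (label) $\ell(u)$ to every node $u$. It also labels the edges from each node $u$ to its $\deg(u)$ children with distinct port numbers from $\{1,\dots,\deg(u)\}$; the encoder is free to choose these port numbers. - The decoder receives only $\ell(u)$ and $\ell(w)$ for nodes $u\neq w$ of some $T\in\mathcal{T}$; the value $\lceil\log n\rceil$, where $n=|T|$, may also be assumed known. It must return $0$ if the next node on the path from $u$ to $w$ is the parent of $u$. Otherwise it must return the port number of the first edge on that path. - The length of the scheme is the maximum label length over all trees in $\mathcal{T}$ and all their nodes. A port assignment is canonical if, for every node $v$ with children $v_1,\dots,v_i$ ordered so that $|T_{v_1}|\ge\dots\ge|T_{v_i}|$, the edge from $v$ to $v_j$ gets port $j$. Here $T_v$ denotes the subtree rooted at $v$; ties may be broken arbitrarily. A scheme is canonical if its encoder always produces a canonical port assignment. *)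

(* Defs.v *)
From Stdlib Require Import Reals.
From mathcomp Require Import all_boot.
Set Implicit Arguments. Unset Strict Implicit. Unset Printing Implicit Defensive.

(* A rooted tree on the node set 'I_n, given by its root and a parent
   function; the root is its own parent and every node reaches the root by
   iterating the parent function (this excludes cycles). *)
Record rtree (n : nat) := RTree {
  rt_root : 'I_n;
  rt_parent : 'I_n -> 'I_n;
  rt_parent_root : rt_parent rt_root = rt_root;
  rt_reach_root : forall u, fconnect rt_parent u rt_root
}.

Section TreeDefs.
Variables (n : nat) (T : rtree n).

Definition in_subtree (v u : 'I_n) : bool := fconnect (rt_parent T) u v.

Definition children (v : 'I_n) : {set 'I_n} :=
  [set u | (u != rt_root T) && (rt_parent T u == v)].

Definition deg (v : 'I_n) : nat := #|children v|.

Definition subtree_size (v : 'I_n) : nat := #|[set u | in_subtree v u]|.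

(* port u = port number of the edge from parent(u) to the non-root node u;
   the ports of the children of each node v are distinct elements of
   {1,...,deg v}. *)
Definition valid_ports (port : 'I_n -> nat) : Prop :=
  (forall u, u != rt_root T -> 1 <= port u <= deg (rt_parent T u)) /\
  (forall u w, u != rt_root T -> w != rt_root T ->
     rt_parent T u = rt_parent T w -> port u = port w -> u = w).

Definition canonical_ports (port : 'I_n -> nat) : Prop :=
  forall u w, u != rt_root T -> w != rt_root T ->
    rt_parent T u = rt_parent T w -> port u < port w ->
    subtree_size w <= subtree_size u.

Definition routes_correctly (label : 'I_n -> bitseq) (port : 'I_n -> nat)
    (dec : bitseq -> bitseq -> nat) : Prop :=
  forall u w, u != w ->
    (~~ in_subtree u w -> dec (label u) (label w) = 0) /\
    (forall c, c \in children u -> in_subtree c w ->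
       dec (label u) (label w) = port c).

End TreeDefs.

Definition lg (x : R) : R := Rdiv (ln x) (ln 2).

Definition label_bound (C : R) (n : nat) : R :=
  Rplus (lg (INR n)) (Rmult C (sqrt (Rmult (lg (INR n)) (lg (lg (INR n)))))).

(* Main.v *)
Require Import Defs.
From mathcomp Require Import zify.
From Stdlib Require Import Reals Lra IndefiniteDescription.
From mathcomp Require Import all_boot.
Set Implicit Arguments. Unset Strict Implicit. Unset Printing Implicit Defensive.
Delimit Scope R_scope with real.

(* A subtree of size s is laid out on an interval of s * Phi(log s) integers,
   where Phi grows by the factor 1 + 1/O(m) whenever the size doubles, with
   m ~ sqrt(log n / log log n), so that positions take log n + O(log n / m)
   bits. The interval of u starts with u, continues with one slot for every
   light child in the order of the ports, and ends with the heavy child, so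
   port(u, w) can be read off the position of w once the slot lengths of u and
   the end of its interval are known. The child with port j has size at most
   s/j, hence its Phi is smaller than Phi(log s) by about 1 + (log j)/m, and
   this slack is spent on rounding: the sizes of the light children are replaced
   by a decreasing step function on a grid of ports and sizes whose resolution
   coarsens as the ratios grow. Both sides of the grid have only O(m log log n)
   cells, so the step function is a lattice path of O(m log log n) bits.
   Children smaller than s by a factor 2^(m O(log log n)) have a slack that is
   polynomial in log n, and a slot proportional to 2^-(log j) suffices. *)

(** * Dyadic grids *)

Section DyadicGrid.
Variable w : nat -> nat.

(* [w k] is one less than the width of the cells that cover [2^k, 2^(k+1)). *)
Definition cell_start (x : nat) : nat :=
  let k := trunc_log 2 x in 2 ^ k + (x - 2 ^ k) %/ (w k).+1 * (w k).+1.

Definition is_start (x : nat) : bool := cell_start x == x.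

Lemma pow_trunc_log x : 0 < x -> 2 ^ trunc_log 2 x <= x < 2 ^ (trunc_log 2 x).+1.
Proof. by move=> x0; apply: trunc_log_bounds. Qed.

Lemma leq_pow_cell_start x : 2 ^ trunc_log 2 x <= cell_start x.
Proof. exact: leq_addr. Qed.

Lemma cell_start_leq x : 0 < x -> cell_start x <= x.
Proof.
move=> /pow_trunc_log /andP [h _]; rewrite /cell_start.
by rewrite -leq_subRL // leq_divM.
Qed.

Lemma leq_cell_start_width x : x <= cell_start x + w (trunc_log 2 x).
Proof.
rewrite /cell_start; set k := trunc_log 2 x.
have := divn_eq (x - 2 ^ k) (w k).+1; have := ltn_pmod (x - 2 ^ k) (ltn0Sn (w k)).
by lia.
Qed.

Lemma cell_start_gt0 x : 0 < cell_start x.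
Proof. by apply: leq_trans (leq_pow_cell_start x); rewrite expn_gt0. Qed.

Lemma trunc_log_cell_start x : 0 < x -> trunc_log 2 (cell_start x) = trunc_log 2 x.
Proof.
move=> x0; apply: trunc_log_eq => //; rewrite leq_pow_cell_start /=.
by apply: leq_ltn_trans (cell_start_leq x0) _; case/andP: (pow_trunc_log x0).
Qed.

Lemma cell_startK x : 0 < x -> is_start (cell_start x).
Proof.
move=> x0; rewrite /is_start {1}/cell_start trunc_log_cell_start //.
by rewrite {2}/cell_start addKn mulnK.
Qed.

(** No cell straddles a power of two: points of one dyadic block are compared by division, and
    otherwise a power of two separates the cell starts. *)
Lemma cell_start_mono x y : 0 < x -> x <= y -> cell_start x <= cell_start y.
Proof.
move=> x0 xy; have y0 : 0 < y by apply: leq_trans xy.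
have := leq_trunc_log 2 xy; rewrite leq_eqVlt => /orP [/eqP E|lt].
  by rewrite /cell_start E leq_add2l leq_mul2r leq_div2r ?orbT // leq_sub2r.
apply: leq_trans (cell_start_leq x0) _; apply: leq_trans (leq_pow_cell_start y).
case/andP: (pow_trunc_log x0) => _ /ltnW h; apply: leq_trans h _.
by rewrite leq_exp2l.
Qed.

Lemma count_is_start k :
  count is_start (iota (2 ^ k) (2 ^ k)) <= (2 ^ k %/ (w k).+1).+1.
Proof.
set s := [seq x <- iota (2 ^ k) (2 ^ k) | is_start x].
rewrite -size_filter -/s.
have inS x : x \in s -> [/\ 2 ^ k <= x, x < 2 ^ k.+1, is_start x & trunc_log 2 x = k].
  rewrite mem_filter mem_iota addnn -mul2n -expnS => /and3P [st lo hi].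
  by split => //; apply: trunc_log_eq => //; rewrite lo.
have us : uniq s by rewrite filter_uniq ?iota_uniq.
have inj : {in s &, injective (fun x => (x - 2 ^ k) %/ (w k).+1)}.
  move=> x y /inS [_ _ /eqP sx kx] /inS [_ _ /eqP sy ky] e.
  by rewrite -sx -sy /cell_start kx ky e.
rewrite -(size_map (fun x => (x - 2 ^ k) %/ (w k).+1)).
rewrite -[X in _ <= X](size_iota 0); apply: uniq_leq_size.
  by rewrite map_inj_in_uniq.
move=> q /mapP [x /inS [lo hi _ _] ->]; rewrite mem_iota ltnS /= leq_div2r //.
by rewrite leq_subLR addnn -mul2n -expnS ltnW.
Qed.

Lemma count_is_start_classes a b : a <= b ->
  count is_start (iota (2 ^ a) (2 ^ b - 2 ^ a))
    <= \sum_(a <= k < b) (2 ^ k %/ (w k).+1).+1.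
Proof.
elim: b => [|b IH]; first by rewrite leqn0 => /eqP ->; rewrite subnn.
rewrite leq_eqVlt => /orP [/eqP ->|]; first by rewrite subnn.
rewrite ltnS => ab; rewrite big_nat_recr //=.
have le : 2 ^ a <= 2 ^ b by rewrite leq_exp2l.
have -> : 2 ^ b.+1 - 2 ^ a = (2 ^ b - 2 ^ a) + 2 ^ b by rewrite expnS; lia.
by rewrite iotaD count_cat subnKC // leq_add ?IH ?count_is_start.
Qed.

End DyadicGrid.

(** Inverts a rank: the number of marked points before [y] is the index of [y] in the list of marked
    points. *)
Lemma nth_filter_iota (p : pred nat) x0 lo len y :
  lo <= y < lo + len -> p y ->
  nth x0 (filter p (iota lo len)) (count p (iota lo (y - lo))) = y.
Proof.
move=> /andP [ly yl] py.
have -> : len = (y - lo) + (lo + len - y).-1.+1 by lia.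
by rewrite iotaD filter_cat nth_cat size_filter ltnn subnn subnKC //= py.
Qed.

(** Each dyadic block of the harmonic sum contributes at most [X]. *)
Lemma sum_divn_pow2 X p : \sum_(1 <= a < 2 ^ p) X %/ a <= p * X.
Proof.
elim: p => [|p IH]; first by rewrite big_geq.
rewrite (@big_cat_nat _ _ _ (2 ^ p)) ?expn_gt0 ?leq_exp2l //=.
rewrite mulSn addnC leq_add //.
apply: (@leq_trans (\sum_(2 ^ p <= a < 2 ^ p.+1) X %/ 2 ^ p)).
  rewrite !big_seq; apply: leq_sum => a; rewrite mem_index_iota => /andP [h _].
  by rewrite leq_div2l ?expn_gt0.
by rewrite sum_nat_const_nat expnS mul2n -addnn addnK mulnC leq_divM.
Qed.

(** * Slot lengths for the light children *)

Lemma sum_dyadic (f : nat -> nat) n :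
  \sum_(2 <= j < 2 ^ n.+1) f j
    = \sum_(1 <= a < n.+1) \sum_(2 ^ a <= j < 2 ^ a.+1) f j.
Proof.
elim: n => [|n IH]; first by rewrite !big_geq.
rewrite big_nat_recr //= -IH -big_cat_nat //= ?leq_exp2l //.
by rewrite -[X in X <= _]expn1 leq_exp2l.
Qed.

(** The clipped shift adds at most [d] copies of the first value and otherwise reuses terms of the
    original sum. *)
Lemma sum_shift (f : nat -> nat) lo n d :
  \sum_(lo <= j < lo + n) f (maxn lo (j - d))
    <= \sum_(lo <= j < lo + n) f j + d * f lo.
Proof.
have E m : m <= d -> \sum_(lo <= j < lo + m) f (maxn lo (j - d)) = m * f lo.
  move=> md; rewrite (eq_big_nat _ _ (F2 := fun=> f lo)).
    by rewrite sum_nat_const_nat addKn.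
  by move=> j /andP [h1 h2]; congr f; lia.
have [nd|/ltnW dn] := leqP n d.
  by rewrite E // (leq_trans _ (leq_addl _ _)) // leq_mul2r nd orbT.
rewrite (@big_cat_nat _ _ _ (lo + d)) ?leq_addr ?leq_add2l //= E // addnC leq_add2r.
rewrite -[X in \sum_(X <= _ < _) _]addn0 -addnA.
have -> : lo + n = lo + (n - d) + d by lia.
rewrite addn0 big_addn addnK [X in _ <= X](@big_cat_nat _ _ _ (lo + (n - d))) /=; try lia.
apply: leq_trans (leq_addr _ _); rewrite !big_seq; apply: leq_sum => j.
by rewrite mem_index_iota addnK => /andP [h _]; rewrite (maxn_idPr h).
Qed.

Section Slots.
Variables (m D A : nat) (Phi : nat -> nat).
Hypotheses (m_gt0 : 0 < m) (D_gt0 : 0 < D).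
Hypothesis Phi_growth : forall k, m.+1 * Phi k <= m * Phi k.+1.
Hypothesis Phi_jump : forall k, 64 * m * D * Phi k <= Phi (k + A).

(** Bernoulli's inequality: [a] steps by the factor [1 + 1/m] gain at least [1 + a/m]. *)
Lemma Phi_growthD k a : (m + a) * Phi k <= m * Phi (k + a).
Proof.
elim: a => [|a IH]; first by rewrite !addn0.
have := Phi_growth (k + a); rewrite !addnS => g.
rewrite -(leq_pmul2l m_gt0); apply: (@leq_trans (m.+1 * ((m + a) * Phi k))).
  by rewrite !mulnA leq_mul2r; apply/orP; right; nia.
apply: (@leq_trans (m.+1 * (m * Phi (k + a)))); first by rewrite leq_mul2l IH orbT.
by rewrite mulnCA leq_mul2l g orbT.
Qed.

Lemma Phi_mono j k : j <= k -> Phi j <= Phi k.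
Proof.
move=> jk; rewrite -(leq_pmul2l m_gt0) -(subnKC jk).
by apply: leq_trans (Phi_growthD _ _); rewrite leq_mul2r leq_addr orbT.
Qed.

(** [capped a / m] measures the relative slack gained when the size drops by the factor [2^a], cut
    off at 1. Each of the next two widths spends a sixteenth of it. *)
Definition capped (a : nat) := minn a m.
Definition port_width (a : nat) := 2 ^ a * capped a %/ (16 * m).
Definition size_width (e k : nat) := 2 ^ k * capped (e - k) %/ (16 * m).

Definition cost (x : nat) := x * Phi (trunc_log 2 x).
(** The extra [1/(16m)] leaves room for rounding the end of an interval to a multiple of a power of
    two. *)
Definition pad (t : nat) := t + t %/ (16 * m).

Lemma pad_mono : {homo pad : x y / x <= y}.
Proof. by move=> x y xy; rewrite leq_add ?leq_div2r. Qed.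

Definition port_rank (j : nat) :=
  count (is_start port_width) (iota 2 (cell_start port_width j - 2)).

(* Rank [0] is kept for the sizes below [2 ^ (e - A)], which get no stair. *)
Definition size_rank (e x : nat) :=
  if 2 ^ (e - A) <= x then
    (count (is_start (size_width e))
       (iota (2 ^ (e - A)) (cell_start (size_width e) x - 2 ^ (e - A)))).+1
  else 0.

(** Computed from the rank alone, this bounds the padded cost of every size in the cell of that
    rank. *)
Definition stair_height (e c : nat) :=
  if c is c'.+1 then
    let y := nth 0 (filter (is_start (size_width e))
                      (iota (2 ^ (e - A)) (2 ^ e - 2 ^ (e - A)))) c' in
    let k := trunc_log 2 y in pad ((y + size_width e k) * Phi k)
  else 0.

(** The second summand is proportional to [2^-a] and serves the children too small for a stair;
    [(2 ^ r).-1] stands for the total size of the light children. *)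
Definition slot (e r : nat) (q : nat -> nat) (j : nat) :=
  let a := trunc_log 2 j in
  (if a <= A then stair_height e (q (port_rank j)) else 0)
    + (2 ^ r).-1 * Phi e %/ (2 ^ a * (16 * m * D)).

Lemma leq_log_pow e x : 0 < x -> (2 ^ e <= x) = (e <= trunc_log 2 x).
Proof.
move=> x0; apply/idP/idP => h; first exact: trunc_log_max.
by apply: leq_trans (trunc_logP (isT : 1 < 2) x0); rewrite leq_exp2l.
Qed.

Lemma stair_height_rank e x : 2 ^ (e - A) <= x < 2 ^ e ->
  stair_height e (size_rank e x) =
    let k := trunc_log 2 x in
    pad ((cell_start (size_width e) x + size_width e k) * Phi k).
Proof.
move=> /andP [lo hi]; have x0 : 0 < x by apply: leq_trans lo; rewrite expn_gt0.
rewrite /size_rank lo /stair_height nth_filter_iota ?trunc_log_cell_start //; last exact: cell_startK.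
rewrite (leq_trans _ (leq_pow_cell_start _ _)) ?leq_exp2l -?leq_log_pow //=.
by rewrite subnKC ?leq_exp2l ?leq_subr // (leq_ltn_trans (cell_start_leq _ x0)).
Qed.

Section Sizes.
Variables (s : nat -> nat) (S R : nat).
Hypothesis s_anti : forall i j, 0 < i -> i <= j -> s j <= s i.
Hypothesis s_mul : forall j, j * s j <= S.
Hypothesis s_sum : \sum_(2 <= j < 2 ^ D.+1) s j = R.

Let e := trunc_log 2 S.
(** The bit length of [R]: it takes only [O(log D)] bits to store and determines [R] up to a factor
    2. *)
Let r := if R == 0 then 0 else (trunc_log 2 R).+1.
Variable q : nat -> nat.
Hypothesis qE : forall j, 1 < j -> trunc_log 2 j <= A ->
  q (port_rank j) = size_rank e (s (cell_start port_width j)).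

Lemma log_size j : 0 < j -> 0 < s j -> trunc_log 2 j + trunc_log 2 (s j) <= e.
Proof.
move=> j0 sj; apply: trunc_log_max => //; apply: leq_trans (s_mul j).
by rewrite expnD leq_mul ?trunc_logP.
Qed.

Lemma R_bounds : R <= (2 ^ r).-1 <= 2 * R.
Proof.
rewrite /r; case: (posnP R) => [->|R0] //.
by have := pow_trunc_log R0; rewrite /= expnS; lia.
Qed.

(** Each of the [j - 1] ports from 2 to [j] carries a size of at least [s j]. *)
Lemma size_leq_R j : 1 < j < 2 ^ D.+1 -> j.-1 * s j <= R.
Proof.
move=> /andP [j1 jD]; rewrite -s_sum (@big_cat_nat _ _ _ j.+1) //=; last by lia.
apply: leq_trans (leq_addr _ _).
have -> : j.-1 * s j = \sum_(2 <= i < j.+1) s j by rewrite sum_nat_const_nat; congr (_ * _); lia.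
rewrite !big_seq; apply: leq_sum => i; rewrite mem_index_iota => /andP [i1 ij].
by apply: s_anti => //; lia.
Qed.

(* The two roundings and the padding use up all but 3/8 of the relative slack
   capped a / m of a port of class a. *)
Lemma stair_bound j : 1 < j -> trunc_log 2 j <= A ->
  8 * m * stair_height e (q (port_rank j))
    <= Phi e * ((8 * m - 3 * capped (trunc_log 2 j)) * s (cell_start port_width j)).
Proof.
move=> j1 jA; rewrite qE //; set x := s _.
case: (leqP (2 ^ (e - A)) x) => [lo|]; last first.
  by rewrite /size_rank => /ltn_geF ->; rewrite muln0.
have x0 : 0 < x by apply: leq_trans lo; rewrite expn_gt0.
have j0 : 0 < j by apply: leq_trans j1.
have st0 := cell_start_gt0 port_width j.
have := log_size st0 x0; rewrite trunc_log_cell_start // -/x.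
set a := trunc_log 2 j; set k := trunc_log 2 x => ake.
have a0 : 0 < a by rewrite /a trunc_log_gt0.
have hi : x < 2 ^ e.
  case/andP: (pow_trunc_log x0) => _ h; apply: leq_trans h _.
  by rewrite leq_exp2l // -/k; lia.
rewrite stair_height_rank ?lo // -/k /=.
have cl := cell_start_leq (size_width e) x0.
have kx : 2 ^ k <= x by case/andP: (pow_trunc_log x0).
pose b := capped (e - k).
have ab : capped a <= b by rewrite /b /capped leq_min geq_minr andbT geq_min; lia.
have b1 : 0 < b by rewrite /b /capped leq_min m_gt0 andbT; lia.
have bm : b <= m by exact: geq_minr.
have w16 : 16 * m * size_width e k <= x * b.
  by rewrite mulnC (leq_trans (leq_divM _ _)) // leq_mul2r kx orbT.
have Pk : (m + b) * Phi k <= m * Phi e.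
  apply: leq_trans (Phi_growthD _ _) _; rewrite leq_mul2l Phi_mono ?orbT //.
  by rewrite /b /capped; lia.
set y := cell_start _ _ in cl *; set w := size_width _ _ in w16 *.
set t := (y + w) * Phi k.
have padE : 16 * m * pad t <= (16 * m).+1 * t.
  by rewrite /pad mulnDr mulSn addnC leq_add2r mulnC leq_divM.
have tE : 16 * m * t <= (16 * m + b) * (x * Phi k).
  by rewrite /t mulnA [X in _ <= X]mulnA leq_mul2r; apply/orP; right; nia.
(* Divided by [256 m^2], this is [(1 + 1/(16m)) (1 + b/(16m)) <= (1 + b/m) (1 - 3b/(8m))]: the
   growth of [Phi] pays for the padding and for the rounding of the size. *)
have key : (16 * m).+1 * (16 * m + b) <= 32 * (m + b) * (8 * m - 3 * b).
  have [c ->] : exists c, m = b + c by exists (m - b); lia.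
  have -> : 8 * (b + c) - 3 * b = 5 * b + 8 * c by lia.
  nia.
have H : 256 * m ^ 2 * (m + b) * pad t
          <= 32 * m * (m + b) * (Phi e * ((8 * m - 3 * b) * x)).
  apply: (@leq_trans (16 * m * (m + b) * ((16 * m).+1 * t))).
    have := leq_mul (leqnn (16 * m * (m + b))) padE; apply: leq_trans.
    by rewrite -mulnn; nia.
  apply: (@leq_trans ((m + b) * (16 * m).+1 * ((16 * m + b) * (x * Phi k)))).
    by have := leq_mul (leqnn ((m + b) * (16 * m).+1)) tE; apply: leq_trans; nia.
  apply: (@leq_trans (((16 * m).+1 * (16 * m + b)) * x * (m * Phi e))).
    have := leq_mul (leqnn ((16 * m).+1 * (16 * m + b) * x)) Pk; apply: leq_trans.
    by nia.
  have := leq_mul key (leqnn (x * (m * Phi e))); rewrite mulnA => h.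
  by apply: leq_trans h _; nia.
have H2 : 8 * m * pad t <= Phi e * ((8 * m - 3 * b) * x).
  rewrite -(@leq_pmul2l (32 * m * (m + b))); last by nia.
  apply: leq_trans H; rewrite -mulnn; nia.
apply: leq_trans H2 _; rewrite leq_mul2l leq_mul2r; apply/orP; right; apply/orP; right.
by rewrite leq_sub2l // leq_mul2l.
Qed.

Let class (f : nat -> nat) a := \sum_(2 ^ a <= j < 2 ^ a.+1) f j.
Let stair j := if trunc_log 2 j <= A then stair_height e (q (port_rank j)) else 0.

Lemma class_log a j : 2 ^ a <= j < 2 ^ a.+1 -> trunc_log 2 j = a.
Proof. exact: trunc_log_eq. Qed.

(** Rounding a port down shifts it by at most [port_width a], which costs at most that many copies
    of the first term of the class. *)
Lemma class_stair a : 0 < a ->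
  8 * m * class stair a
    <= Phi e * ((8 * m - 3 * capped a) * (class s a + port_width a * s (2 ^ a))).
Proof.
move=> a0; have E : 2 ^ a.+1 = 2 ^ a + 2 ^ a by rewrite expnS mul2n -addnn.
have := sum_shift s (2 ^ a) (2 ^ a) (port_width a); rewrite -E.
rewrite -/(class s a) => h.
apply: (@leq_trans (Phi e * ((8 * m - 3 * capped a)
   * \sum_(2 ^ a <= j < 2 ^ a.+1) s (maxn (2 ^ a) (j - port_width a))))); last first.
  by rewrite !leq_mul2l h !orbT.
rewrite /class !big_distrr /= !big_seq; apply: leq_sum => j.
rewrite mem_index_iota => ja; have ej := class_log ja; case/andP: ja => lo _.
have j1 : 1 < j by apply: leq_trans lo; rewrite -[X in X < _](expn0 2) ltn_exp2l.
rewrite /stair ej; case: ifP => [aA|_]; last by rewrite muln0.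
apply: leq_trans (stair_bound j1 _) _; rewrite ej //.
rewrite !leq_mul2l; apply/orP; right; apply/orP; right.
apply: s_anti; first by rewrite leq_max expn_gt0.
rewrite geq_max -{1}ej leq_pow_cell_start /= leq_subLR addnC -ej.
exact: leq_cell_start_width.
Qed.

(* A class overflows into the previous one, which has half as many ports. *)
Lemma class_overflow a : 0 < a ->
  8 * m * (port_width a.+1 * s (2 ^ a.+1)) <= 2 * capped a * class s a.
Proof.
move=> a0; have w : 16 * m * port_width a.+1 <= 2 ^ a.+1 * capped a.+1.
  by rewrite mulnC leq_divM.
have c2 : capped a.+1 <= 2 * capped a by rewrite /capped; lia.
have h : 2 ^ a * s (2 ^ a.+1) <= class s a.
  have {1}-> : 2 ^ a = 2 ^ a.+1 - 2 ^ a by rewrite expnS mul2n -addnn addnK.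
  rewrite -sum_nat_const_nat /class !big_seq; apply: leq_sum => j.
  rewrite mem_index_iota => /andP [lo /ltnW hi]; apply: s_anti => //.
  by apply: leq_trans lo; rewrite expn_gt0.
rewrite -(@leq_pmul2l 2) //.
have w2 := leq_mul w (leqnn (s (2 ^ a.+1))).
have h2 := leq_mul c2 h; rewrite expnS in w w2 h h2 *.
apply: (@leq_trans (2 * (capped a.+1 * (2 ^ a * s (2 * 2 ^ a))))).
  by apply: leq_trans (leq_trans w2 _); lia.
by apply: (@leq_trans (2 * (2 * capped a * class s a))); rewrite ?leq_mul2l ?h2 //; lia.
Qed.

(** Of the slack [3 * capped a] of a class, [2 * capped a] absorbs the overflow of the next class.
    The remaining [capped a >= 1] frees the fraction [1/(8m)] for the second summand of [slot]. *)
Lemma sum_stair : 8 * m * (\sum_(2 <= j < 2 ^ D.+1) stair j) <= Phi e * ((8 * m).-1 * R).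
Proof.
(* The second summand reserves room for the overflow of the next class. *)
have st n : 8 * m * (\sum_(1 <= a < n.+2) class stair a)
       + Phi e * (2 * capped n.+1 * class s n.+1)
     <= Phi e * \sum_(1 <= a < n.+2) (8 * m - capped a) * class s a.
  elim: n => [|n IH].
    rewrite !big_nat1; have := class_stair (ltnSn 0).
    (* Class 1 has no predecessor to absorb an overflow, but its cells are single ports. *)
    have -> : port_width 1 = 0 by rewrite /port_width divn_small // /capped; lia.
    rewrite mul0n addn0 => h.
    apply: leq_trans (leq_add h (leqnn _)) _; rewrite -mulnDr leq_mul2l.
    by apply/orP; right; rewrite -mulnDl leq_mul2r /capped; lia.
  rewrite !(big_nat_recr n.+2) //= !mulnDr.
  apply: leq_trans (leq_add (leq_add (leqnn _) (class_stair _)) (leqnn _)) _ => //.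
  have ov := leq_mul (leqnn (Phi e)) (class_overflow (ltn0Sn n)).
  have h : Phi e * ((8 * m - 3 * capped n.+2) * (port_width n.+2 * s (2 ^ n.+2)))
           <= Phi e * (2 * capped n.+1 * class s n.+1).
    by apply: leq_trans ov; rewrite leq_mul2l leq_mul2r leq_subr !orbT.
  have g : Phi e * ((8 * m - 3 * capped n.+2) * class s n.+2)
             + Phi e * (2 * capped n.+2 * class s n.+2)
           = Phi e * ((8 * m - capped n.+2) * class s n.+2).
    by rewrite -mulnDr -mulnDl; congr (_ * (_ * _)); rewrite /capped; lia.
  rewrite !mulnDr; lia.
rewrite sum_dyadic -s_sum sum_dyadic.
case: D D_gt0 => // n _; apply: leq_trans (leq_trans (leq_addr _ _) (st n)) _.
rewrite leq_mul2l big_distrr /= !big_seq; apply/orP; right; apply: leq_sum => a.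
rewrite mem_index_iota => /andP [a1 _]; rewrite leq_mul2r; apply/orP; right.
by rewrite /capped; lia.
Qed.

Let rest j := (2 ^ r).-1 * Phi e %/ (2 ^ trunc_log 2 j * (16 * m * D)).

(** Up to rounding down, all [D] classes receive the same total, [(2 ^ r).-1 * Phi e / (16 m D)],
    and [(2 ^ r).-1 <= 2 R]. *)
Lemma sum_rest : 8 * m * (\sum_(2 <= j < 2 ^ D.+1) rest j) <= Phi e * R.
Proof.
have rE : forall a, class rest a <= (2 ^ r).-1 * Phi e %/ (16 * m * D).
  move=> a; rewrite /class (eq_big_nat _ _ (F2 := fun=>
    (2 ^ r).-1 * Phi e %/ (16 * m * D) %/ 2 ^ a)).
    rewrite sum_nat_const_nat expnS mul2n -addnn addnK mulnC; exact: leq_divM.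
  by move=> j /class_log; rewrite /rest => ->; rewrite -divnMA (mulnC (2 ^ a)).
rewrite sum_dyadic -(@leq_pmul2l (2 * D)) ?muln_gt0 //.
apply: (@leq_trans (16 * m * D * (D * ((2 ^ r).-1 * Phi e %/ (16 * m * D))))).
  have -> : 2 * D * (8 * m * \sum_(1 <= a < D.+1) class rest a)
     = 16 * m * D * \sum_(1 <= a < D.+1) class rest a by lia.
  rewrite leq_mul2l; apply/orP; right.
  have := @leq_sum _ (index_iota 1 D.+1) xpredT (class rest) _ (fun a _ => rE a).
  by rewrite sum_nat_const_nat subn1.
have := leq_divM ((2 ^ r).-1 * Phi e) (16 * m * D); case/andP: R_bounds => _ h.
have h2 := leq_mul (leqnn (D * Phi e)) h; move: (_ %/ _) => z hz.
have h3 := leq_mul (leqnn D) hz; lia.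
Qed.

Lemma sum_slot : \sum_(2 <= j < 2 ^ D.+1) slot e r q j <= R * Phi e.
Proof.
rewrite -(@leq_pmul2l (8 * m)) ?muln_gt0 ?m_gt0 // /slot.
rewrite big_split /= mulnDr.
apply: leq_trans (leq_add sum_stair sum_rest) _; rewrite -mulnDr.
have -> : (8 * m).-1 * R + R = 8 * m * R by rewrite addnC -mulSn prednK // muln_gt0.
by rewrite mulnCA (mulnC R).
Qed.

(** With a stair, both roundings only enlarge the slot. Without one, the drop of [Phi] over [A]
    levels makes the second summand large enough. *)
Lemma pad_cost_leq_slot j : 1 < j < 2 ^ D.+1 -> pad (cost (s j)) <= slot e r q j.
Proof.
move=> jb; have /andP [j1 jD] := jb; have j0 : 0 < j by apply: leq_trans j1.
case: (posnP (s j)) => [-> |sj]; first by rewrite /cost mul0n /pad div0n.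
have st0 := cell_start_gt0 port_width j.
have sc : s j <= s (cell_start port_width j) by apply: s_anti => //; apply: cell_start_leq.
have x0 : 0 < s (cell_start port_width j) by apply: leq_trans sc.
have := log_size st0 x0; rewrite trunc_log_cell_start // => ax.
(* The test is on the size at the cell start, whose rank is the one that [q] returns. *)
rewrite /slot; case: (leqP (2 ^ (e - A)) (s (cell_start port_width j))) => [lo|hi].
  apply: leq_trans (leq_addr _ _).
  have lo' := lo; rewrite leq_log_pow // in lo'.
  have aA : trunc_log 2 j <= A by lia.
  have a0 : 0 < trunc_log 2 j by rewrite trunc_log_gt0.
  have /andP [_ xk] := pow_trunc_log x0.
  rewrite aA qE // stair_height_rank ?lo /=; last first.
    by apply: leq_trans xk _; rewrite leq_exp2l //; lia.
  apply: pad_mono; rewrite /cost; apply: leq_mul.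
    by apply: leq_trans sc _; apply: leq_cell_start_width.
  by apply/Phi_mono/leq_trunc_log.
apply: leq_trans (leq_addl _ _).
rewrite leq_divRL ?muln_gt0 ?expn_gt0 ?m_gt0 //.
have p2 : pad (cost (s j)) <= 2 * cost (s j) by rewrite /pad mul2n -addnn leq_add2l leq_div.
have kA : trunc_log 2 (s j) + A <= e.
  have := leq_ltn_trans sc hi; rewrite ltnNge leq_log_pow // -ltnNge; lia.
(* The constant 64 combines the 16 of [slot], a factor 2 for the padding and a factor 2 from
   [2 ^ a <= 2 (j - 1)]. *)
have Pe : 64 * m * D * Phi (trunc_log 2 (s j)) <= Phi e.
  by apply: leq_trans (Phi_jump _) _; apply: Phi_mono.
have aj : 2 ^ trunc_log 2 j <= 2 * j.-1.
  by apply: leq_trans (trunc_logP (isT : 1 < 2) j0) _; lia.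
have sR := size_leq_R jb; have /andP [Rr _] := R_bounds.
apply: leq_trans (leq_mul p2 (leqnn _)) _; rewrite /cost.
move: (trunc_log 2 (s j)) Pe => k Pe.
have h1 : 2 ^ trunc_log 2 j * s j <= 2 * (2 ^ r).-1.
  apply: leq_trans (leq_mul aj (leqnn _)) _; rewrite -mulnA leq_mul2l /=.
  exact: leq_trans Rr.
have h2 := leq_mul h1 (leqnn (32 * m * D * Phi k)).
have h3 := leq_mul (leqnn (2 ^ r).-1) Pe.
by apply: leq_trans (leq_trans _ (leq_trans h2 _)) h3; lia.
Qed.

End Sizes.
End Slots.

(** * Counting the slot functions *)

Lemma bin_leq_pow2 n k : 'C(n, k) <= 2 ^ n.
Proof.
elim: n k => [|n IH] [|k] //; rewrite ?bin0 ?expn_gt0 //.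
by rewrite binS expnS mul2n -addnn leq_add.
Qed.

Lemma sum_nth_leq_sumn (z : seq nat) b : \sum_(0 <= i < b) nth 0 z i <= sumn z.
Proof.
elim: z b => [|x z IH] b; first by rewrite big1 // => i _; rewrite nth_nil.
case: b => [|b]; first by rewrite big_geq.
by rewrite big_nat_recl //= leq_add2l.
Qed.

Lemma nth_sorted_geq (z : seq nat) i j :
  sorted geq z -> i <= j -> nth 0 z j <= nth 0 z i.
Proof.
move=> sz ij; have [jz|zj] := ltnP j (size z); last by rewrite nth_default.
apply: (sorted_leq_nth _ _ 0 sz) => //.
- by move=> y x w /= yx wy; apply: leq_trans wy yx.
- by move=> x /=.
- by rewrite inE (leq_ltn_trans ij).
Qed.

Section Family.
Variables (m D A : nat) (Phi : nat -> nat).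
Hypotheses (m_gt0 : 0 < m) (D_gt0 : 0 < D).
Hypothesis Phi_growth : forall k, m.+1 * Phi k <= m * Phi k.+1.
Hypothesis Phi_jump : forall k, 64 * m * D * Phi k <= Phi (k + A).

(** A common bound on the numbers of cells on the port side and on the size side of the grid. *)
Definition grid_size := \sum_(1 <= a < A.+1) (16 * m %/ capped m a).+1.

Lemma div_width a k : 0 < a ->
  2 ^ k %/ (2 ^ k * capped m a %/ (16 * m)).+1 <= 16 * m %/ capped m a.
Proof.
move=> a0; have c0 : 0 < capped m a by rewrite /capped leq_min a0.
rewrite leq_divRL // -(@leq_pmul2l (2 ^ k)) ?expn_gt0 //.
set X := 2 ^ k * capped m a; set w := (X %/ _).+1.
have /ltnW h : X < w * (16 * m) by rewrite ltn_ceil // muln_gt0.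
rewrite -/X mulnCA; apply: leq_trans (leq_mul (leqnn (2 ^ k %/ w)) h) _.
by rewrite mulnA leq_mul2r leq_divM orbT.
Qed.

Lemma count_port_starts :
  count (is_start (port_width m)) (iota 2 (2 ^ A.+1 - 2)) <= grid_size.
Proof.
have := @count_is_start_classes (port_width m) 1 A.+1 (ltn0Sn A).
rewrite expn1 => h; apply: leq_trans h _; rewrite /grid_size !big_seq.
by apply: leq_sum => a; rewrite mem_index_iota ltnS => /andP [a0 _]; apply: div_width.
Qed.

Lemma count_size_starts e :
  count (is_start (size_width m e)) (iota (2 ^ (e - A)) (2 ^ e - 2 ^ (e - A)))
    <= grid_size.
Proof.
apply: leq_trans (count_is_start_classes _ (leq_subr A e)) _.
apply: (@leq_trans (\sum_(e - A <= k < e) (16 * m %/ capped m (e - k)).+1)).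
  rewrite !big_seq; apply: leq_sum => k; rewrite mem_index_iota => /andP [_ ke].
  by apply: div_width; rewrite subn_gt0.
rewrite /grid_size; elim: A => [|b IH]; first by rewrite subn0 !big_geq.
have [eb|be] := leqP e b.
  have -> : e - b.+1 = e - b by lia.
  by apply: leq_trans IH _; rewrite [X in _ <= X]big_nat_recr //= leq_addr.
rewrite big_ltn; last by lia.
have -> : (e - b.+1).+1 = e - b by lia.
have -> : e - (e - b.+1) = b.+1 by lia.
by rewrite [X in _ <= X]big_nat_recr //= addnC leq_add2r.
Qed.

Lemma size_rank_leq e x : x < 2 ^ e -> size_rank m A e x <= grid_size.+1.
Proof.
move=> xe; rewrite /size_rank; case: ifP => // lo; rewrite ltnS.
have x0 : 0 < x by apply: leq_trans lo; rewrite expn_gt0.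
apply: leq_trans (count_size_starts e).
have h : cell_start (size_width m e) x - 2 ^ (e - A) <= 2 ^ e - 2 ^ (e - A).
  by rewrite leq_sub2r // (leq_trans (cell_start_leq _ x0)) // ltnW.
by rewrite -[X in _ <= count _ (iota _ X)](subnKC h) iotaD count_cat leq_addr.
Qed.

Lemma size_rank_mono e x y : x <= y -> size_rank m A e x <= size_rank m A e y.
Proof.
move=> xy; rewrite /size_rank; case: ifP => // lo; rewrite (leq_trans lo xy) ltnS.
have x0 : 0 < x by apply: leq_trans lo; rewrite expn_gt0.
have h := leq_sub2r (2 ^ (e - A)) (cell_start_mono (size_width m e) x0 xy).
by rewrite -[X in _ <= count _ (iota _ X)](subnKC h) iotaD count_cat leq_addr.
Qed.

Let starts := filter (is_start (port_width m)) (iota 2 (2 ^ A.+1 - 2)).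
Let K := size starts.
Let M := grid_size.+1.

(* Ranks decrease with the port, so their complements to [M] are stored. *)
Definition profile := {t : K.-tuple 'I_M.+1 | sorted leq (map val t)}.

(** Monotone tuples are lattice paths in a [K] by [M] grid, and there are ['C(K + M, K)] of
    these. *)
Lemma card_profile : #|{: profile}| <= 2 ^ (2 * grid_size.+1).
Proof.
rewrite card_sig.
have -> : #|[pred t : K.-tuple 'I_M.+1 | sorted leq (map val t)]| = 'C(K + M, K).
  by rewrite -card_sorted_tuples cardsE.
apply: leq_trans (bin_leq_pow2 _ _) _; rewrite leq_exp2l // mul2n -addnn leq_add2r.
by rewrite /K size_filter (leq_trans count_port_starts).
Qed.

(** The components are [e], [r] and the complemented ranks. *)
Definition slot_info := ('I_D.+1 * 'I_D.+2 * profile)%type.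

Definition slots (i : slot_info) (j : nat) :=
  slot m D A Phi i.1.1 i.1.2 (fun c => M - nth 0 (map val (val i.2)) c) j.

Lemma card_slot_info : #|{: slot_info}| <= D.+1 * D.+2 * 2 ^ (2 * grid_size.+1).
Proof. by rewrite !card_prod !card_ord leq_mul2l card_profile orbT. Qed.

Lemma slots_exist (z : seq nat) :
  sorted geq z -> (sumn z).+1 < 2 ^ D.+1 ->
  exists i : slot_info,
    (forall j, 0 < j < size z -> pad m (cost Phi (nth 0 z j)) <= slots i j.+1) /\
    \sum_(2 <= j < 2 ^ D.+1) slots i j
      <= sumn (behead z) * Phi (trunc_log 2 (sumn z).+1).
Proof.
(* Ports count from 1; those beyond the end of [z] carry the default size 0. *)
move=> sz SD; pose s j := nth 0 z j.-1; set S := (sumn z).+1.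
pose R := \sum_(2 <= j < 2 ^ D.+1) s j.
have s_anti i j : 0 < i -> i <= j -> s j <= s i.
  by move=> i0 ij; apply: nth_sorted_geq => //; lia.
have s_mul j : j * s j <= S.
  case: j => // j; apply: (@leq_trans (sumn z)) => //.
  apply: leq_trans (sum_nth_leq_sumn z j.+1).
  have -> : j.+1 * s j.+1 = \sum_(0 <= i < j.+1) s j.+1 by rewrite sum_nat_const_nat subn0.
  rewrite !big_seq; apply: leq_sum => i; rewrite mem_index_iota ltnS => ij.
  exact: nth_sorted_geq.
have RS : R <= sumn (behead z).
  apply: leq_trans (sum_nth_leq_sumn (behead z) (2 ^ D.+1 - 2)).
  rewrite /R -[2]/(0 + 2) big_addn.
  by apply: leq_sum => i _; rewrite nth_behead /s addn2.
set e := trunc_log 2 S.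
have eD : e < D.+1 by rewrite -(@ltn_exp2l 2) //; apply: leq_ltn_trans (trunc_logP _ _) _.
set r := if R == 0 then 0 else (trunc_log 2 R).+1.
have rD : r < D.+2.
  rewrite /r; case: eqP => // _; rewrite !ltnS in eD *; apply: leq_trans eD.
  rewrite leq_trunc_log // (leq_trans RS) // /S.
  by case: (z) => //= a b; rewrite ltnW // ltnS leq_addl.
(* From port 2 on, [2 * s j <= S < 2 ^ (e + 1)], as [size_rank_leq] requires; the heavy child may
   violate this. *)
have se j : 1 < j -> s j < 2 ^ e.
  move=> j1; have h := s_mul j; rewrite -(@ltn_pmul2l 2) // -expnS.
  apply: leq_ltn_trans (leq_trans _ h) _; first by rewrite leq_mul2r j1 orbT.
  exact: trunc_log_ltn.
have st1 i : i < K -> 1 < nth 0 starts i.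
  move=> iK; have : nth 0 starts i \in starts by apply: mem_nth.
  by rewrite mem_filter mem_iota => /and3P [].
pose t := [tuple (inord (M - size_rank m A e (s (nth 0 starts i))) : 'I_M.+1) | i < K].
have tE i : i < K ->
    nth 0 (map val t) i = M - size_rank m A e (s (nth 0 starts i)).
  move=> iK; rewrite (nth_map ord0) ?size_tuple //.
  rewrite -[i]/(val (Ordinal iK)) -tnth_nth tnth_mktuple /= inordK //.
  by rewrite ltnS leq_subr.
have ts : sorted leq (map val t).
  apply/(sortedP 0) => i; rewrite size_map size_tuple => iK.
  rewrite !tE ?(ltnW iK) //; apply/leq_sub2l/size_rank_mono/s_anti.
    by apply: ltnW; apply: st1; apply: ltnW.
  have : sorted ltn starts by apply: sorted_filter (iota_ltn_sorted _ _); apply: ltn_trans.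
  by move/(sortedP 0)/(_ i iK)/ltnW.
pose i0 : slot_info := (Ordinal eD, Ordinal rD, exist _ t ts).
pose q c := M - nth 0 (map val t) c.
have qE j : 1 < j -> trunc_log 2 j <= A ->
    q (port_rank m j) = size_rank m A e (s (cell_start (port_width m) j)).
  move=> j1 jA; have j0 : 0 < j by apply: ltnW.
  set y := cell_start _ _.
  have y1 : 1 < y.
    apply: leq_trans (leq_pow_cell_start _ _).
    by rewrite -[2]expn1 leq_exp2l // trunc_log_gt0.
  have yA : y < 2 ^ A.+1.
    apply: leq_ltn_trans (cell_start_leq _ j0) _.
    by apply: leq_trans (trunc_log_ltn j (isT : 1 < 2)) _; rewrite leq_exp2l.
  have yb : 2 <= y < 2 + (2 ^ A.+1 - 2) by rewrite y1 subnKC // (leq_trans y1) // ltnW.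
  have ny : nth 0 starts (port_rank m j) = y.
    by apply: nth_filter_iota yb _; apply: cell_startK.
  (* Outside the list, [nth] would return 0, whereas [y > 1]. *)
  have rK : port_rank m j < K.
    by rewrite ltnNge; apply/negP => h; move: ny y1; rewrite nth_default // => <-.
  rewrite /q tE // ny subKn //; apply: size_rank_leq; apply: se y1.
exists i0; split.
  move=> j /andP [j0 jz]; rewrite /slots /=.
  have [jD|Dj] := ltnP j.+1 (2 ^ D.+1).
    have := @pad_cost_leq_slot m D A Phi m_gt0 D_gt0 Phi_growth Phi_jump
      s S R s_anti s_mul erefl q qE j.+1.
    by rewrite ltnS j0 jD => /(_ isT).
  (* Here [j + 1 >= 2 ^ (D + 1) > S], so a positive size would contradict [s_mul]. *)
  have := s_mul j.+1; rewrite leqNgt /s /= => /negP h.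
  case: (posnP (nth 0 z j)) => [->|p]; first by rewrite /cost /pad mul0n div0n.
  case: h; apply: (leq_trans SD); apply: leq_trans Dj _.
  by rewrite leq_pmulr.
apply: leq_trans (sum_slot m_gt0 D_gt0 Phi_growth s_anti s_mul erefl qE) _.
by rewrite leq_mul2r RS orbT.
Qed.

(** The classes [a <= m] form a harmonic sum and the later ones give 16 each; the 17 includes the
    successor in every term. *)
Lemma grid_size_leq p : m < 2 ^ p -> grid_size <= 16 * m * p + 17 * A.
Proof.
move=> mp; rewrite /grid_size.
apply: (@leq_trans (\sum_(1 <= a < A.+1) (16 * m %/ a * (a <= m) + 17))).
  rewrite !big_seq; apply: leq_sum => a; rewrite mem_index_iota => /andP [a0 _].
  rewrite /capped; case: (leqP a m) => am; first by rewrite /= muln1 addnS ltnS leq_addr.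
  by rewrite mulnK // muln0.
rewrite big_split /= sum_nat_const_nat subn1 /= [A * 17]mulnC leq_add2r.
rewrite [16 * m * p]mulnC; apply: leq_trans (sum_divn_pow2 (16 * m) p).
case: (leqP A.+1 (2 ^ p)) => Ap.
  rewrite [X in _ <= X](@big_cat_nat _ _ _ A.+1) //=; apply: leq_trans (leq_addr _ _).
  by apply: leq_sum => a _; rewrite -[X in _ <= X]muln1 leq_mul2l leq_b1 orbT.
rewrite (@big_cat_nat _ _ _ (2 ^ p)) ?expn_gt0 //=; last exact: ltnW.
rewrite [X in _ + X]big1_seq ?addn0.
  by apply: leq_sum => a _; rewrite -[X in _ <= X]muln1 leq_mul2l leq_b1 orbT.
move=> a; rewrite mem_index_iota => /andP [_ /andP [pa _]].
by rewrite leqNgt (leq_trans mp pa) muln0.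
Qed.

End Family.

(** * Rooted trees *)

Section Tree.
Variables (n : nat) (T : rtree n).
Local Notation par := (rt_parent T).
Local Notation root := (rt_root T).
Local Notation tsize := (subtree_size T).

Lemma reach_root u : exists k, iter k par u == root.
Proof.
by exists (findex par u root); rewrite iter_findex // rt_reach_root.
Qed.

Definition depth u := ex_minn (reach_root u).

Lemma depth_par u : u != root -> depth u = (depth (par u)).+1.
Proof.
move=> ur; rewrite /depth; case: ex_minnP => -[|k] hk mk.
  by rewrite /= (negbTE ur) in hk.
case: ex_minnP => l hl ml; apply/eqP; rewrite eqSS eqn_leq ml ?andbT -?iterSr //.
by rewrite -ltnS mk // iterSr.
Qed.

Lemma tree_ind (P : 'I_n -> Prop) :
  (forall u, (u != root -> P (par u)) -> P u) -> forall u, P u.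
Proof.
move=> IH u; have [k] := ubnP (depth u); elim: k u => // k IHk u uk.
by apply: IH => ur; apply: IHk; rewrite -ltnS -depth_par.
Qed.

Lemma in_subtree_refl u : in_subtree T u u.
Proof. exact: connect0. Qed.

Lemma in_subtree_trans v u w : in_subtree T u v -> in_subtree T v w -> in_subtree T u w.
Proof. by move=> uv vw; apply: connect_trans vw uv. Qed.

Lemma in_subtree_par u : in_subtree T (par u) u.
Proof. exact: fconnect1. Qed.

Lemma in_subtree_step v u : in_subtree T v u ->
  u = v \/ u != root /\ in_subtree T v (par u).
Proof.
move=> /iter_findex; case: findex => [|k]; first by left.
rewrite iterSr => <-; case: (eqVneq u root) => [->|ur]; last first.
  by right; split => //; apply: fconnect_iter.
by left; rewrite rt_parent_root iter_fix // rt_parent_root.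
Qed.

Lemma depth_in_subtree v u : in_subtree T v u -> u != v -> depth v < depth u.
Proof.
elim/tree_ind: u => u IH /in_subtree_step [-> |[ur vpu] uv]; first by rewrite eqxx.
rewrite (depth_par ur) ltnS; case: (eqVneq (par u) v) => [-> //|puv].
exact: ltnW (IH ur vpu puv).
Qed.

Lemma in_subtree_anti u v : in_subtree T u v -> in_subtree T v u -> u = v.
Proof.
move=> uv vu; apply/eqP; apply: contraT => ne.
have := depth_in_subtree vu ne; rewrite eq_sym in ne.
by move/ltn_trans/(_ (depth_in_subtree uv ne)); rewrite ltnn.
Qed.

Lemma childrenP v c : reflect (c != root /\ par c = v) (c \in children T v).
Proof. by rewrite inE; apply: (iffP andP) => -[-> /eqP]. Qed.

Lemma in_subtree_child v w : in_subtree T v w -> w != v ->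
  exists2 c, c \in children T v & in_subtree T c w.
Proof.
elim/tree_ind: w => w IH /in_subtree_step [-> |[wr vpw] _]; first by rewrite eqxx.
case: (eqVneq (par w) v) => [pv|pv].
  by exists w; [apply/childrenP | apply: in_subtree_refl].
have [c cv cw] := IH wr vpw pv; exists c => //.
exact: in_subtree_trans cw (in_subtree_par w).
Qed.

Lemma in_subtree_comparable u v w : in_subtree T u w -> in_subtree T v w ->
  in_subtree T u v \/ in_subtree T v u.
Proof.
elim/tree_ind: w => w IH uw vw.
case: (in_subtree_step uw) => [<-|[wr upw]]; first by right.
case: (in_subtree_step vw) => [<-|[_ vpw]]; first by left.
exact: IH.
Qed.

Lemma child_in_subtree v c : c \in children T v -> in_subtree T v c.
Proof. by case/childrenP => _ <-; apply: in_subtree_par. Qed.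

Lemma child_neq v c : c \in children T v -> c != v.
Proof.
case/childrenP => cr <-; apply/eqP => e.
by have := depth_par cr; rewrite -e; lia.
Qed.

Lemma not_in_child v c : c \in children T v -> ~~ in_subtree T c v.
Proof.
move=> cv; apply: contra (child_neq cv) => h.
by apply/eqP; apply: in_subtree_anti h (child_in_subtree cv).
Qed.

Lemma siblings_disjoint v c c' w : c \in children T v -> c' \in children T v ->
  in_subtree T c w -> in_subtree T c' w -> c = c'.
Proof.
suff H x y : x \in children T v -> y \in children T v -> in_subtree T x y -> x = y.
  move=> cv c'v cw c'w; case: (in_subtree_comparable cw c'w) => h; first exact: H.
  by apply/esym/H.
move=> xv yv /in_subtree_step [-> //|[_]]; case/childrenP: (yv) => _ -> h.
by have := not_in_child xv; rewrite h.
Qed.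

(** Double counting: every [w != v] below [v] lies below exactly one child. *)
Lemma subtree_size_children v : tsize v = (\sum_(c in children T v) tsize c).+1.
Proof.
have E u : tsize u = \sum_w (in_subtree T u w : nat).
  by rewrite /subtree_size cardsE -sum1_card big_mkcond.
rewrite E (eq_bigr _ (fun c _ => E c)) exchange_big /= -add1n.
have -> : 1 = \sum_w (w == v : nat) by rewrite (bigD1 v) //= eqxx big1 // => i /negbTE ->.
rewrite -big_split; apply: eq_bigr => w _ /=.
case: (eqVneq w v) => [->|wv].
  rewrite in_subtree_refl big1 // => c /not_in_child; by case: in_subtree.
rewrite add0n; case: (boolP (in_subtree T v w)) => [h|h].
  have [c cv cw] := in_subtree_child h wv.
  rewrite (bigD1 c) //= cw big1 // => c' /andP [c'v ne].
  case: (boolP (in_subtree T c' w)) => // c'w.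
  by rewrite (siblings_disjoint cv c'v cw c'w) eqxx in ne.
rewrite big1 // => c cv; case: (boolP (in_subtree T c w)) => // cw.
by rewrite (in_subtree_trans (child_in_subtree cv) cw) in h.
Qed.

Lemma subtree_size_leq v : tsize v <= n.
Proof. by rewrite /subtree_size -[X in _ <= X]card_ord max_card. Qed.

(** * Ports by decreasing subtree size *)

Definition by_size : rel 'I_n := fun x y => tsize y <= tsize x.

Definition ordered_children v := sort by_size (enum (children T v)).

Definition child_sizes v := map tsize (ordered_children v).

Definition size_port u := (index u (ordered_children (par u))).+1.

Lemma by_size_total : total by_size.
Proof. by move=> x y; apply: leq_total. Qed.

Lemma mem_ordered_children v c : (c \in ordered_children v) = (c \in children T v).
Proof. by rewrite mem_sort mem_enum. Qed.

Lemma size_ordered_children v : size (ordered_children v) = deg T v.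
Proof. by rewrite size_sort -cardE. Qed.

Lemma sorted_child_sizes v : sorted geq (child_sizes v).
Proof. by rewrite /child_sizes sorted_map; apply: sort_sorted by_size_total _. Qed.

Lemma sumn_child_sizes v : (sumn (child_sizes v)).+1 = tsize v.
Proof.
rewrite subtree_size_children sumnE big_map; congr _.+1.
rewrite (perm_big (enum (children T v))) ?perm_sort //=.
by rewrite big_enum.
Qed.

Lemma index_child v c : c \in children T v ->
  [/\ size_port c = (index c (ordered_children v)).+1,
      index c (ordered_children v) < size (child_sizes v) &
      nth 0 (child_sizes v) (index c (ordered_children v)) = tsize c].
Proof.
move=> cv; have [_ e] := childrenP _ _ cv.
have h : c \in ordered_children v by rewrite mem_ordered_children.
rewrite /size_port e size_map index_mem h; split => //.
by rewrite (nth_map c) ?index_mem // nth_index.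
Qed.

Lemma size_port_valid : valid_ports T size_port.
Proof.
have mem u : u != root -> u \in ordered_children (par u).
  by move=> ur; rewrite mem_ordered_children; apply/childrenP.
split => [u ur|u w ur wr e].
  by rewrite /size_port ltn0Sn -size_ordered_children index_mem mem.
move=> [] h; have := nth_index u (mem u ur); rewrite h e.
by rewrite nth_index // mem.
Qed.

Lemma size_port_canonical : canonical_ports T size_port.
Proof.
move=> u w ur wr e; rewrite /size_port e ltnS => h.
have uv : u \in children T (par w) by apply/childrenP.
have wv : w \in children T (par w) by apply/childrenP.
have [_ _ <-] := index_child uv; have [_ _ <-] := index_child wv.
exact: nth_sorted_geq (sorted_child_sizes _) (ltnW h).
Qed.

End Tree.

(** * The layout and its decoding *)

Section Rounding.
Variable m : nat.
Hypothesis m_gt0 : 0 < m.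

(* Given [a], the end [E] is determined by [t] and by the difference of the two
   quotients, that is, by [O(log m + log log x)] bits. *)
Lemma round_end a x : 0 < x -> exists E t,
  [/\ 2 ^ t %| E, a + x <= E <= a + pad m x,
      E %/ 2 ^ t < a %/ 2 ^ t + 64 * m & t <= trunc_log 2 x].
Proof.
(* [2 ^ t] is the largest power of two within the padding [y]. If [y = 0] then [t = 0], and nothing
   is rounded. *)
move=> x0; set y := x %/ (16 * m); set t := trunc_log 2 y.
have p0 : 0 < 2 ^ t by rewrite expn_gt0.
have yt : 2 ^ t <= y.+1.
  by rewrite /t; case: (posnP y) => [->|y0] //; apply/leqW/trunc_logP.
have xt : x < 2 ^ t * (32 * m).
  have : y < 2 ^ t.+1 by apply: trunc_log_ltn.
  by rewrite /y ltn_divLR ?muln_gt0 ?m_gt0 // expnS; lia.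
have tx : t <= trunc_log 2 x by rewrite leq_trunc_log // leq_div.
pose E := (a + x + (2 ^ t).-1) %/ 2 ^ t.
have e1 := divn_eq (a + x + (2 ^ t).-1) (2 ^ t); rewrite -/E in e1.
have e2 := ltn_pmod (a + x + (2 ^ t).-1) p0.
exists (E * 2 ^ t), t; split => //.
- by rewrite dvdn_mull.
- by rewrite /pad -/y; lia.
rewrite mulnK // /E -addnA (divn_eq a (2 ^ t)) -addnA divnMDl //.
have -> : (a %/ 2 ^ t * 2 ^ t + a %% 2 ^ t) %/ 2 ^ t = a %/ 2 ^ t.
  by rewrite -divn_eq.
rewrite ltn_add2l ltn_divLR //; have := ltn_pmod a p0.
have : 2 ^ t <= 2 ^ t * m by rewrite leq_pmulr.
by lia.
Qed.

End Rounding.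

Section Layout.
Variables (m D : nat) (Phi : nat -> nat) (n : nat) (T : rtree n).
Hypotheses (m_gt0 : 0 < m) (n_lt : n < 2 ^ D.+1).
Hypotheses (Phi_gt0 : forall k, 0 < Phi k) (Phi_homo : {homo Phi : j k / j <= k}).
Variable g : 'I_n -> nat -> nat.
Hypothesis g_pad : forall u j, 0 < j < size (child_sizes T u) ->
  pad m (cost Phi (nth 0 (child_sizes T u) j)) <= g u j.+1.
Hypothesis g_sum : forall u, \sum_(2 <= j < 2 ^ D.+1) g u j
  <= sumn (behead (child_sizes T u)) * Phi (trunc_log 2 (subtree_size T u)).

Local Notation par := (rt_parent T).
Local Notation root := (rt_root T).
Local Notation tsize := (subtree_size T).
Local Notation port := (size_port T).
Let span u := cost Phi (tsize u).
Let top := 2 ^ D.+1.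

Definition prefix u j := \sum_(2 <= i < j) g u i.

(* The heavy child (port 1) comes after all the slots of its siblings, so that
   the region of every node of a heavy path ends at the same place. *)
Definition offset c :=
  (prefix (par c) (if port c == 1 then top else port c)).+1.

Definition position u := \sum_(i < depth T u) offset (iter i par u).

Lemma position_par u : u != root -> position u = position (par u) + offset u.
Proof.
move=> ur; rewrite /position (depth_par ur) big_ord_recl addnC; congr (_ + _).
by apply: eq_bigr => i _; rewrite -iterSr.
Qed.

Lemma prefix_mono u : {homo prefix u : i j / i <= j}.
Proof.
move=> i j ij; rewrite /prefix; case: (leqP 2 i) => i2; last by rewrite big_geq // ltnW.
by rewrite (@big_cat_nat _ _ _ i 2 j) //= leq_addr.
Qed.

Lemma prefixS u j : 1 < j -> prefix u j.+1 = prefix u j + g u j.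
Proof. by move=> j1; rewrite /prefix big_nat_recr. Qed.

Lemma size_port_gt0 u : 0 < port u. Proof. by []. Qed.

Lemma port_ltn_top c : c != root -> port c < top.
Proof.
move=> cr; apply: leq_ltn_trans n_lt.
have [/(_ c cr) /andP [_ h] _] := size_port_valid T.
by apply: leq_trans h _; rewrite /deg -[X in _ <= X]card_ord max_card.
Qed.

Lemma tsize_gt0 u : 0 < tsize u.
Proof. by rewrite subtree_size_children. Qed.

Lemma span_gt0 u : 0 < span u.
Proof. by rewrite muln_gt0 tsize_gt0 Phi_gt0. Qed.

Lemma pad_span_leq v c : c \in children T v -> port c != 1 -> pad m (span c) <= g v (port c).
Proof.
move=> cv; have [-> lt e] := index_child cv; rewrite eqSS -lt0n => i0.
by rewrite /span -e g_pad // i0.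
Qed.

(** The successor is the integer of [v] itself, paid for by the unit that [v] contributes to its own
    subtree size. *)
Lemma prefix_top_leq v : (prefix v top).+1 <= span v.
Proof.
apply: leq_trans (_ : (sumn (behead (child_sizes T v))).+1 * Phi (trunc_log 2 (tsize v)) <= _).
  by rewrite mulSn; exact: leq_add (Phi_gt0 _) (g_sum v).
rewrite leq_mul2r -sumn_child_sizes ltnS; apply/orP; right.
by case: (child_sizes T v) => //= a s; rewrite leq_addl.
Qed.

(** A light child lies within the slots. For the heavy child the sizes of the light siblings, of [v]
    and of the child add up to [tsize v], all weighted by at most the [Phi] of [v]. *)
Lemma offset_room v c : c \in children T v -> offset c + span c <= span v.
Proof.
move=> cv; have [cr pv] := childrenP _ _ _ cv; have [pE lt e] := index_child cv.
have Pc : Phi (trunc_log 2 (tsize c)) <= Phi (trunc_log 2 (tsize v)).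
  rewrite Phi_homo // leq_trunc_log // (subtree_size_children T v) (bigD1 c) //=.
  by rewrite ltnW // ltnS leq_addr.
rewrite /offset pv; case: eqP => [p1|/eqP p1]; last first.
  apply: leq_trans (prefix_top_leq v); rewrite addSn ltnS.
  apply: leq_trans (_ : prefix v (port c).+1 <= _).
    rewrite prefixS; last by have := size_port_gt0 c; case: (port c) p1 => [|[]].
    rewrite leq_add2l; apply: leq_trans (pad_span_leq cv p1).
    by rewrite /pad leq_addr.
  by apply: prefix_mono; apply: port_ltn_top.
have {p1} i0 : index c (ordered_children T v) = 0 by move: p1; rewrite pE => -[].
rewrite i0 in lt e.
apply: leq_trans (_ : (sumn (behead (child_sizes T v))).+1 * Phi (trunc_log 2 (tsize v))
                        + tsize c * Phi (trunc_log 2 (tsize v)) <= _).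
  apply: leq_add; last by rewrite leq_mul2l Pc orbT.
  by rewrite mulSn; exact: leq_add (Phi_gt0 _) (g_sum v).
rewrite -mulnDl leq_mul2r -{2}sumn_child_sizes; apply/orP; right.
by case: (child_sizes T v) lt e => //= a s _ ->; rewrite addSn addnC.
Qed.

Lemma position_child v c : c \in children T v -> position c = position v + offset c.
Proof. by case/childrenP => cr <-; apply: position_par. Qed.

Lemma position_bounds v w : in_subtree T v w ->
  position v <= position w < position v + span v.
Proof.
have [k] := ubnP (tsize v); elim: k v => // k IH v vk vw.
case: (eqVneq w v) => [->|wv]; first by rewrite leqnn -addn1 leq_add2l span_gt0.
have [c cv cw] := in_subtree_child vw wv.
have ck : tsize c < k.
  rewrite ltnS in vk; apply: leq_trans vk.
  rewrite [X in _ < X]subtree_size_children (bigD1 c) //= ltnS.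
  by rewrite leq_addr.
have /andP [lo hi] := IH c ck cw; have := offset_room cv.
by rewrite (position_child cv) in lo hi *; lia.
Qed.

Lemma slot_end v c w : c \in children T v -> port c != 1 -> in_subtree T c w ->
  position w < (position v + prefix v (port c).+1).+1.
Proof.
move=> cv p1 /position_bounds /andP [_ h]; apply: leq_trans h _.
have [cr pv] := childrenP _ _ _ cv.
rewrite (position_child cv) /offset pv (negbTE p1) prefixS; last first.
  by have := size_port_gt0 c; case: (port c) p1 => [|[]].
have sg : span c <= g v (port c) := leq_trans (leq_addr _ _) (pad_span_leq cv p1).
lia.
Qed.

Lemma slot_start v c w : c \in children T v -> in_subtree T c w ->
  (position v + prefix v (if port c == 1 then top else port c)).+1 <= position w.
Proof.
move=> cv /position_bounds /andP [h _]; apply: leq_trans h.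
by have [_ pv] := childrenP _ _ _ cv; rewrite (position_child cv) /offset pv addnS.
Qed.

Lemma port_inj v c c' : c \in children T v -> c' \in children T v ->
  port c = port c' -> c = c'.
Proof.
case/childrenP => cr e; case/childrenP => c'r e' pp.
by have [_] := size_port_valid T; apply => //; rewrite e e'.
Qed.

(** [E] may lie beyond the interval of [u], as long as no outside node is positioned in between. The
    bounds on the quotients and on [t] make [E] cheap to store. *)
Definition region_end u E t :=
  [/\ 2 ^ t %| E, E %/ 2 ^ t < position u %/ 2 ^ t + 64 * m,
      position u + span u <= E, t <= trunc_log 2 (cost Phi n) &
      forall w, ~~ in_subtree T u w -> position w < position u \/ E <= position w].

(** Induction from the root. A light child has a padded slot that contains the rounded end; a heavy
    child has no padding and inherits the end of its parent, since its siblings all lie before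
    it. *)
Lemma region_end_exists u : exists E t, region_end u E t.
Proof.
have spann v : trunc_log 2 (span v) <= trunc_log 2 (cost Phi n).
  by apply/leq_trunc_log/leq_mul; rewrite ?Phi_homo ?leq_trunc_log ?subtree_size_leq.
elim/(tree_ind (T := T)): u => c; case: (eqVneq c root) => [-> _|cr /(_ isT)].
  have [E [t [d /andP [lo _] h tx]]] := round_end m_gt0 (position root) (span_gt0 root).
  exists E, t; split => //; first exact: leq_trans tx (spann _).
  by move=> w; rewrite /in_subtree rt_reach_root.
set v := par c => -[E0 [t0 [d0 h0 lo0 tx0 out0]]].
have cv : c \in children T v by apply/childrenP.
have oc : position c = position v + offset c := position_par cr.
have room := offset_room cv.
have offE : offset c = (prefix v (if port c == 1 then top else port c)).+1 by [].
case: (eqVneq (port c) 1) => [p1|p1].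
  (* Positions increase along a heavy path, so the difference of the quotients to the fixed end only
     shrinks. *)
  exists E0, t0; split => //.
  - by apply: leq_trans h0 _; rewrite leq_add2r leq_div2r // oc leq_addr.
  - by apply: leq_trans lo0; rewrite oc -addnA leq_add2l.
  move=> w cw; case: (boolP (in_subtree T v w)) => [vw|/out0 [lt|]]; last 2 first.
  - by left; apply: leq_trans lt _; rewrite oc leq_addr.
  - by right.
  left; case: (eqVneq w v) => [->|wv]; first by rewrite oc offE addnS ltnS leq_addr.
  have [c' c'v c'w] := in_subtree_child vw wv.
  have p' : port c' != 1.
    apply/eqP => p'; move: cw; rewrite (port_inj cv c'v) ?p1 //; by rewrite c'w.
  apply: leq_trans (slot_end c'v p' c'w) _.
  rewrite oc offE p1 eqxx addnS ltnS leq_add2l; apply: prefix_mono.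
  by apply: port_ltn_top; case/childrenP: c'v.
have [E [t [d /andP [lo hi] h tx]]] := round_end m_gt0 (position c) (span_gt0 c).
exists E, t; split => //; first exact: leq_trans tx (spann _).
rewrite (negbTE p1) in offE.
have p2 : 1 < port c by have := size_port_gt0 c; case: (port c) p1 => [|[]].
have Ele : E <= (position v + prefix v (port c).+1).+1.
  apply: leq_trans hi _; rewrite oc offE prefixS //.
  by have := pad_span_leq cv p1; lia.
have ptop := port_ltn_top cr.
move=> w cw; case: (boolP (in_subtree T v w)) => [vw|/out0 [lt|]]; last 2 first.
- by left; apply: leq_trans lt _; rewrite oc leq_addr.
- move=> Ew; right; apply: leq_trans Ele (leq_trans _ (leq_trans lo0 Ew)).
  rewrite -addnS leq_add2l; apply: leq_trans (prefix_top_leq v).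
  by rewrite ltnS; apply: prefix_mono.
case: (eqVneq w v) => [->|wv]; first by left; rewrite oc offE addnS ltnS leq_addr.
have [c' c'v c'w] := in_subtree_child vw wv.
have ne : port c' != port c.
  apply/eqP => p'; move: cw; rewrite (port_inj cv c'v) //; by rewrite c'w.
(* As in [offset], port 1 ranks after all other ports. *)
case: (ltnP (port c) (if port c' == 1 then top else port c')) => lt.
  right; apply: leq_trans Ele (leq_trans _ (slot_start c'v c'w)).
  by rewrite ltnS leq_add2l; apply: prefix_mono.
left; case: (eqVneq (port c') 1) lt => [_|p' lt]; first by rewrite leqNgt ptop.
apply: leq_trans (slot_end c'v p' c'w) _; rewrite oc offE addnS ltnS leq_add2l.
by apply: prefix_mono; rewrite ltn_neqAle ne.
Qed.

End Layout.

(** Here [x] and [y] are the positions of source and target, and [E] is the region end of the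
    source. The count includes [j = 0], where the sum is empty, so it yields the port and not its
    predecessor. *)
Definition decode_port (D : nat) (g : nat -> nat) (x E y : nat) : nat :=
  let sums j := \sum_(2 <= i < j) g i in
  if (y <= x) || (E <= y) then 0
  else if sums (2 ^ D.+1) <= y - x.+1 then 1
  else count (fun j => sums j.+1 <= y - x.+1) (iota 0 (2 ^ D.+1)).

Section Decoding.
Variables (m D : nat) (Phi : nat -> nat) (n : nat) (T : rtree n).
Hypotheses (m_gt0 : 0 < m) (n_lt : n < 2 ^ D.+1).
Hypotheses (Phi_gt0 : forall k, 0 < Phi k) (Phi_homo : {homo Phi : j k / j <= k}).
Variable g : 'I_n -> nat -> nat.
Hypothesis g_pad : forall u j, 0 < j < size (child_sizes T u) ->
  pad m (cost Phi (nth 0 (child_sizes T u) j)) <= g u j.+1.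
Hypothesis g_sum : forall u, \sum_(2 <= j < 2 ^ D.+1) g u j
  <= sumn (behead (child_sizes T u)) * Phi (trunc_log 2 (subtree_size T u)).

Let pos := position D T g.

Lemma decode_port_outside u w E t : region_end m D Phi T g u E t ->
  ~~ in_subtree T u w -> decode_port D (g u) (pos u) E (pos w) = 0.
Proof.
case=> _ _ _ _ out /out h; rewrite /decode_port /pos.
by case: h => [/ltnW -> //|->]; rewrite orbT.
Qed.

Lemma decode_port_child u w c E t : region_end m D Phi T g u E t ->
  c \in children T u -> in_subtree T c w ->
  decode_port D (g u) (pos u) E (pos w) = size_port T c.
Proof.
case=> _ _ lo _ _ cu cw; have uw := in_subtree_trans (child_in_subtree cu) cw.
have /andP [_ hi] := position_bounds m_gt0 n_lt Phi_gt0 Phi_homo g_pad g_sum uw.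
have st := slot_start m_gt0 n_lt Phi_gt0 Phi_homo g_pad g_sum cu cw.
have en := slot_end m_gt0 n_lt Phi_gt0 Phi_homo g_pad g_sum cu _ cw.
rewrite /decode_port /pos leqNgt (leq_trans _ st) ?ltnS ?leq_addr //=.
rewrite leqNgt (leq_trans hi lo) /=.
rewrite -/(prefix g u (2 ^ D.+1)).
have dE j : (prefix g u j <= position D T g w - (position D T g u).+1)
   = (position D T g u + prefix g u j < position D T g w).
  by rewrite leq_subRL ?addSn // (leq_trans _ st) // ltnS leq_addr.
rewrite dE; case: (eqVneq (size_port T c) 1) st en => [p1|p1] st en.
  by rewrite st.
have {}en := en isT; have [cr _] := childrenP _ _ _ cu.
have ptop := port_ltn_top n_lt cr.
rewrite ltnNge -ltnS (leq_trans en) ?ltnS ?leq_add2l; last exact: prefix_mono.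
rewrite /=; set p := size_port T c in st en ptop *.
have -> : 2 ^ D.+1 = p + (2 ^ D.+1 - p) by rewrite subnKC // ltnW.
rewrite iotaD count_cat -[RHS]addn0; congr (_ + _).
  rewrite -[RHS](size_iota 0); apply/eqP; rewrite -all_count; apply/allP => i.
  rewrite mem_iota => /andP [_ ip]; rewrite -/(prefix g u i.+1) dE.
  by apply: leq_trans st; rewrite ltnS leq_add2l; apply: prefix_mono.
apply/eqP; rewrite -leqn0 leqNgt -has_count; apply/hasPn => i.
rewrite mem_iota => /andP [pi _]; rewrite -/(prefix g u i.+1) dE -leqNgt -ltnS.
by apply: leq_trans en _; rewrite ltnS leq_add2l; apply: prefix_mono.
Qed.

End Decoding.

(** * Choice of the parameters *)

Lemma bitseq_code (X : finType) b : #|X| <= 2 ^ b ->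
  exists2 f : X -> bitseq, injective f & forall x, size (f x) = b.
Proof.
move=> Xb; pose s := enum {: b.-tuple bool}.
have ss : size s = 2 ^ b by rewrite -cardE card_tuple card_bool.
exists (fun x => val (nth [tuple of nseq b false] s (enum_rank x))); last first.
  by move=> x; exact: size_tuple.
move=> x y /val_inj e; apply: enum_rank_inj; apply: val_inj; apply/eqP.
have lt (z : X) : enum_rank z < size s by rewrite ss; exact: (leq_trans (ltn_ord _) Xb).
by rewrite -(nth_uniq [tuple of nseq b false] (lt x) (lt y) (enum_uniq _)) e.
Qed.

(* [2 ^ (k / m)] interpolated linearly between the multiples of [m]. *)
Definition growth (m k : nat) : nat := 2 ^ (k %/ m) * (m + k %% m).

Section Growth.
Variable m : nat.
Hypothesis m_gt0 : 0 < m.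

Lemma growth_gt0 k : 0 < growth m k.
Proof. by rewrite muln_gt0 expn_gt0 addn_gt0 m_gt0. Qed.

(** Inside a block the second factor rises by 1 from a value below [2m], a relative gain of at least
    [1/(2m)]; hence the slots are used with [2 * m] in place of [m]. *)
Lemma growth_step k : (2 * m).+1 * growth m k <= 2 * m * growth m k.+1.
Proof.
rewrite /growth; have r := ltn_pmod k m_gt0; have e := divn_eq k m.
set q := k %/ m in e *; set s := k %% m in r e *.
case: (ltnP s.+1 m) => sm.
  have e' : k.+1 = q * m + s.+1 by lia.
  have -> : k.+1 %/ m = q by rewrite e' divnMDl // divn_small // addn0.
  have -> : k.+1 %% m = s.+1 by rewrite e' modnMDl modn_small.
  rewrite mulnCA [X in _ <= X]mulnCA leq_mul2l; apply/orP; right; nia.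
(* At the end of a block [2m - 1] becomes [2m], written as [m] with the exponent raised by one. *)
have e' : k.+1 = q.+1 * m + 0 by lia.
have -> : k.+1 %/ m = q.+1 by rewrite e' divnMDl // div0n addn0.
have -> : k.+1 %% m = 0 by rewrite e' modnMDl mod0n.
have h : (2 * m).+1 * (m + s) <= 2 * m * (2 * m) by nia.
by have := leq_mul (leqnn (2 ^ q)) h; rewrite expnS; lia.
Qed.

Lemma growth_jump k q : growth m (k + m * q) = 2 ^ q * growth m k.
Proof.
by rewrite /growth addnC (mulnC m) divnMDl // modnMDl expnD mulnA.
Qed.

Lemma growth_leq k : growth m k <= 2 ^ (k %/ m) * (2 * m).
Proof. by rewrite leq_mul2l mul2n -addnn leq_add2l ltnW ?orbT // ltn_pmod. Qed.

End Growth.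

Section Scheme.
Variables (n m : nat).
Let D := trunc_log 2 n.
Let l := trunc_log 2 D.
Hypotheses (m_gt0 : 0 < m) (m_leq : m <= D) (l_gt0 : 0 < l).
Let Phi := growth m.
(** Over [A] levels [Phi] gains [2^7 * 2^(l+1) * 2^(l+1)], enough for [64 * (2 * m) * D] because
    [m <= D < 2^(l+1)]. *)
Let A := m * (2 * l + 9).

Let mu_gt0 : 0 < 2 * m. Proof. by rewrite muln_gt0. Qed.
Let D_gt0 : 0 < D. Proof. exact: leq_trans m_leq. Qed.
Let n_gt0 : 0 < n.
Proof. by move: D_gt0; rewrite /D; case: n => //; rewrite trunc_log0. Qed.
Let n_lt : n < 2 ^ D.+1. Proof. exact: trunc_log_ltn. Qed.
Let D_lt : D < 2 ^ l.+1. Proof. exact: trunc_log_ltn. Qed.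

Let jump k : 64 * (2 * m) * D * Phi k <= Phi (k + A).
Proof.
rewrite /Phi /A growth_jump // leq_mul2r; apply/orP; right.
have -> : 2 * l + 9 = 7 + (l.+1 + l.+1) by lia.
rewrite !expnD mulnA -[64 * _ * m]/(128 * m) mulnA.
have -> : 64 * 2 * m * D = 2 ^ 7 * (m * D) by rewrite [2 ^ 7]/= mulnA.
rewrite -mulnA leq_mul2l leq_mul ?orbT //; last exact: ltnW.
exact: leq_trans m_leq (ltnW D_lt).
Qed.

Let homo : {homo Phi : j k / j <= k}.
Proof. exact: Phi_mono mu_gt0 (growth_step m_gt0). Qed.

(** Position, rounding exponent [t], difference of the two quotients in [region_end], and slot
    function. *)
Definition label_info :=
  ('I_(cost Phi n) * 'I_(trunc_log 2 (cost Phi n)).+1 * 'I_(64 * (2 * m))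
     * slot_info (2 * m) D A)%type.

Definition decode_info (x y : label_info) : nat :=
  let: (p, t, d, i) := x in
  decode_port D (slots Phi i) p ((p %/ 2 ^ t + d) * 2 ^ t) y.1.1.1.

Lemma label_info_exists (T : rtree n) : exists lab : 'I_n -> label_info,
  forall u w, u != w ->
    (~~ in_subtree T u w -> decode_info (lab u) (lab w) = 0) /\
    (forall c, c \in children T u -> in_subtree T c w ->
       decode_info (lab u) (lab w) = size_port T c).
Proof.
have Hex u : exists i : slot_info (2 * m) D A,
    (forall j, 0 < j < size (child_sizes T u) ->
       pad (2 * m) (cost Phi (nth 0 (child_sizes T u) j)) <= slots Phi i j.+1) /\
    \sum_(2 <= j < 2 ^ D.+1) slots Phi i j
      <= sumn (behead (child_sizes T u)) * Phi (trunc_log 2 (subtree_size T u)).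
  rewrite -sumn_child_sizes.
  apply: slots_exist (growth_step m_gt0) jump _ (sorted_child_sizes T u) _ => //.
  by rewrite sumn_child_sizes (leq_ltn_trans (subtree_size_leq T u)).
have [f Hf] := fin_all_exists Hex.
pose g u := slots Phi (f u).
have g_pad u j : 0 < j < size (child_sizes T u) ->
    pad (2 * m) (cost Phi (nth 0 (child_sizes T u) j)) <= g u j.+1 by case: (Hf u) => h _; apply: h.
have g_sum u : \sum_(2 <= j < 2 ^ D.+1) g u j
    <= sumn (behead (child_sizes T u)) * Phi (trunc_log 2 (subtree_size T u)).
  by case: (Hf u).
have pos_lt u : position D T g u < cost Phi n.
  have h := rt_reach_root T u.
  have := position_bounds mu_gt0 n_lt (growth_gt0 m_gt0) homo g_pad g_sum h.
  have -> : position D T g (rt_root T) = 0.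
    rewrite /position big1 // => -[i]; rewrite /depth; case: ex_minnP => k _ /(_ 0).
    by rewrite eqxx => /(_ isT); rewrite leqn0 => /eqP ->.
  rewrite add0n => /andP [_ hi]; apply: leq_trans hi _.
  by rewrite leq_mul ?homo ?leq_trunc_log ?subtree_size_leq.
have ex u : exists x : label_info, let: (p, t, d, i) := x in
    [/\ p = position D T g u :> nat, i = f u &
        region_end (2 * m) D Phi T g u ((p %/ 2 ^ t + d) * 2 ^ t) t].
  have [E [t reg]] := region_end_exists mu_gt0 n_lt (growth_gt0 m_gt0) homo g_pad g_sum u.
  have [dv lt lo tle _] := reg.
  have ge : position D T g u %/ 2 ^ t <= E %/ 2 ^ t.
    by rewrite leq_div2r // (leq_trans _ lo) // leq_addr.
  have dlt : E %/ 2 ^ t - position D T g u %/ 2 ^ t < 64 * (2 * m).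
    by rewrite ltn_subLR.
  exists (Ordinal (pos_lt u), Ordinal (tle : t < (trunc_log 2 (cost Phi n)).+1),
          Ordinal dlt, f u).
  by split => //=; rewrite subnKC // divnK.
have [lab labP] := fin_all_exists ex; exists lab => u w uw.
move: (labP u) (labP w); rewrite /decode_info.
case: (lab u) => [[[p t] d] i]; case: (lab w) => [[[p' t'] d'] i'] /=.
move=> [-> -> reg] [-> _ _]; split => [|c]; first exact: decode_port_outside reg.
exact: (decode_port_child mu_gt0 n_lt (growth_gt0 m_gt0) homo g_pad g_sum reg).
Qed.

(** Beyond [D + 1 + D / m], the components take [5 l + 17] bits and [2 (grid_size + 1)] for the
    profile. Since [grid_size <= 66 m l + 249 m], this is at most [654 m l]. *)
Lemma card_label_info : #|{: label_info}| <= 2 ^ (D.+1 + (D %/ m + 660 * (m * l))).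
Proof.
have m_lt : m <= 2 ^ l.+1 := leq_trans m_leq (ltnW D_lt).
have lD : l < D by apply: leq_trans (trunc_logP (isT : 1 < 2) D_gt0); apply: ltn_expl.
have ml : l <= m * l by rewrite leq_pmull.
have cn : cost Phi n <= 2 ^ (D.+1 + (D %/ m + l.+2)).
  rewrite /cost expnD leq_mul //; first exact: ltnW.
  apply: leq_trans (growth_leq m_gt0 _) _; rewrite expnD leq_mul2l.
  by rewrite [2 ^ l.+2]expnS leq_mul2l m_lt !orbT.
have tn : (trunc_log 2 (cost Phi n)).+1 <= 2 ^ (l + 4).
  have := leq_trunc_log 2 cn; rewrite trunc_expnK // addnC => h.
  have dm := leq_div D m; have := D_lt; rewrite addnC expnD expnS; lia.
have g1 : grid_size (2 * m) A <= 16 * (2 * m) * l.+3 + 17 * A.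
  apply: (grid_size_leq _ mu_gt0); rewrite expnS ltn_mul2l /= (leq_ltn_trans m_lt) //.
  by rewrite ltn_exp2l.
rewrite 3!card_prod !card_ord.
apply: leq_trans (_ : 2 ^ (D.+1 + (D %/ m + l.+2)) * 2 ^ (l + 4) * 2 ^ (l + 8)
  * (2 ^ l.+1 * 2 ^ l.+2 * 2 ^ (2 * (grid_size (2 * m) A).+1)) <= _).
  have c64 : 64 * (2 * m) <= 2 ^ (l + 8).
    rewrite addnC expnD -[2 ^ 8]/(128 * 2) -mulnA -expnS mulnA.
    by rewrite leq_mul.
  have cs := card_slot_info D A mu_gt0.
  rewrite leq_mul ?leq_mul // (leq_trans cs) // ?leq_mul //.
  by move: D_lt; rewrite [2 ^ l.+2]expnS; lia.
have lm : m <= m * l by rewrite leq_pmulr.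
rewrite -!expnD leq_exp2l //; move: g1; rewrite /A.
move: (grid_size _ _) (D %/ m) => gs z g1; lia.
Qed.

Lemma scheme_exists :
  exists (enc : rtree n -> ('I_n -> bitseq) * ('I_n -> nat))
         (dec : bitseq -> bitseq -> nat),
    forall T : rtree n,
      [/\ valid_ports T (enc T).2, canonical_ports T (enc T).2,
          routes_correctly T (enc T).1 (enc T).2 dec &
          forall u, size ((enc T).1 u) = D.+1 + (D %/ m + 660 * (m * l))].
Proof.
have [code code_inj code_size] := bitseq_code card_label_info.
have [lab labP] := functional_choice _ label_info_exists.
(* The decoder depends on [n] and [m] but not on the tree; strings that are not codes give 0. *)
pose dec s t := if [pick x | code x == s] is Some x then
  if [pick y | code y == t] is Some y then decode_info x y else 0 else 0.
have decE x y : dec (code x) (code y) = decode_info x y.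
  rewrite /dec; case: pickP => [x' /eqP/code_inj ->|/(_ x)]; last by rewrite eqxx.
  by case: pickP => [y' /eqP/code_inj ->|/(_ y)]; last by rewrite eqxx.
exists (fun T => (fun u => code (lab T u), size_port T)), dec => T; split => //=.
- exact: size_port_valid.
- exact: size_port_canonical.
by move=> u w uw; rewrite !decE; apply: labP.
Qed.

End Scheme.

(** * Binary logarithms over the reals and the final bound *)

Lemma leq_lg (k : nat) (x : R) : Rle (pow 2 k) x -> Rle (INR k) (lg x).
Proof.
move=> kx; have l2 : (0 < ln 2)%real by rewrite -ln_1; apply: ln_increasing; lra.
apply: (Rmult_le_reg_r (ln 2)) => //; rewrite /lg /Rdiv Rmult_assoc Rinv_l ?Rmult_1_r; last lra.
rewrite -ln_pow; last lra.
have p : (0 < 2 ^ k)%real by apply: pow_lt; lra.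
case: kx => [kx|<-]; [left; exact: ln_increasing | right].
by [].
Qed.

Lemma INR_expn2 k : INR (2 ^ k) = pow 2 k.
Proof. by elim: k => //= k IH; rewrite expnS mult_INR IH. Qed.

Lemma leqR a b : a <= b -> Rle (INR a) (INR b).
Proof. by move=> ab; apply: le_INR; apply/leP. Qed.

Lemma INR_leq_sqrt a x : (INR a * INR a <= x)%real -> (INR a <= sqrt x)%real.
Proof.
move=> h; rewrite -(sqrt_Rsqr (INR a)); first exact: sqrt_le_1_alt.
exact: pos_INR.
Qed.

(* For every sufficiently large n there is a canonical routing labeling scheme
   (encoder = labels + ports, decoder) for the family of rooted trees on n
   nodes whose labels have length <= log n + C sqrt(log n log log n). *)
Theorem mainTheorem3 :
  exists (C : R) (N0 : nat), forall n : nat, N0 <= n ->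
    exists (enc : rtree n -> ('I_n -> bitseq) * ('I_n -> nat))
           (dec : bitseq -> bitseq -> nat),
      forall T : rtree n,
        let label := (enc T).1 in
        let port := (enc T).2 in
        [/\ valid_ports T port,
            canonical_ports T port,
            routes_correctly T label port dec &
            forall u : 'I_n, Rle (INR (size (label u))) (label_bound C n)].
Proof.
(* 663 is 660 for [m * l], 2 for [D / m] and 1 for the successor in [D.+1]; [n >= 4] gives [D >= 2]
   and [l >= 1]. *)
exists 663%real, 4 => n n4; set D := trunc_log 2 n; set l := trunc_log 2 D.
have D2 : 1 < D by apply: trunc_log_max.
have l1 : 0 < l by rewrite trunc_log_gt0.
have lD : l < D.
  by apply: leq_trans (trunc_logP (isT : 1 < 2) (ltnW D2)); apply: ltn_expl.
(* The largest [m] with [m^2 l <= D] balances [D / m] against [m * l], and both become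
   [O(sqrt(D l))]. *)
have ex : exists m, m * m * l <= D by exists 0.
have bd m : m * m * l <= D -> m <= D by move=> h; nia.
case: (ex_maxnP ex bd) => m mD mmax.
have m1 : 0 < m by apply: mmax; rewrite !mul1n ltnW.
have Dm : D < m.+1 * m.+1 * l by rewrite ltnNge; apply/negP => /mmax; rewrite ltnn.
have [enc [dec H]] := scheme_exists m1 (bd m mD) l1.
exists enc, dec => T; have [vp cp rc sz] := H T; split => // u.
rewrite sz -/D -/l /label_bound.
have Dx : Rle (INR D) (lg (INR n)).
  apply: leq_lg; rewrite -INR_expn2; apply: leqR; apply: trunc_logP => //.
  exact: leq_trans n4.
have lx : Rle (INR l) (lg (lg (INR n))).
  apply: leq_lg; rewrite -INR_expn2; apply: Rle_trans Dx; apply: leqR.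
  by apply: trunc_logP => //; apply: ltnW.
set y := sqrt _; have y0 : Rle 0 y by apply: sqrt_pos.
have sq z c : z * z <= c * c * (D * l) -> Rle (INR z) (INR c * y)%real.
  move=> h; have := leqR h; rewrite !mult_INR => hR.
  have -> : (INR c * y = sqrt (INR c * INR c * (lg (INR n) * lg (lg (INR n)))))%real.
    rewrite sqrt_mult_alt ?sqrt_square //; first exact: pos_INR.
    by apply: Rmult_le_pos; apply: pos_INR.
  apply: INR_leq_sqrt; apply: Rle_trans hR _; apply: Rmult_le_compat_l.
    by apply: Rmult_le_pos; apply: pos_INR.
  by apply: Rmult_le_compat => //; apply: pos_INR.
have h1 : Rle 1 (1 * y)%real by apply: (sq 1 1); rewrite !mul1n muln_gt0 l1 ltnW.
have h2 : Rle (INR (m * l)) (1 * y)%real.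
  by apply: (sq _ 1); rewrite !mul1n; nia.
have h3 : Rle (INR (D %/ m)) (2 * y)%real.
  apply: (sq _ 2); have := leq_divM D m; set z := D %/ m => zm.
  (* By maximality of [m], [D < (m + 1)^2 l <= 4 m^2 l]. *)
  have D4 : D <= 4 * (m * m * l) by apply: leq_trans (ltnW Dm) _; nia.
  rewrite -(@leq_pmul2l (m * m)) ?muln_gt0 ?m1 //.
  apply: leq_trans (_ : D * D <= _); first by have := leq_mul zm zm; lia.
  by have := leq_mul (leqnn D) D4; lia.
have -> : INR (D.+1 + (D %/ m + 660 * (m * l)))
    = (INR D + 1 + (INR (D %/ m) + 660 * INR (m * l)))%real.
  rewrite -S_INR -[IZR 660]/(IZR (Z.of_nat 660)) -INR_IZR_INZ -mult_INR -plus_INR.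
  exact: plus_INR.
lra.
Qed.
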